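(* Let $G=(V,E)$ be a finite simple graph with $n\ge 2$ vertices and $m$ edges, and let $(G,p)$ define a grillage in the plane. Let $\ell$ be the dimension of the space of non-trivial liftings of the grillage and let $s$ be the dimension of the space of its Whiteley stresses. Then $$\ell-s+3=2n-m.$$
   Context: Let $\rho:\mathbb{R}^2\to\mathbb{R}^2$ be the counter-clockwise rotation through $\pi/2$. A grillage $(G,p)$ consists of a graph $G=(V,E)$ with $V=\{1,\dots,n\}$ and a set of $n$ distinct lines $L_1,\dots,L_n$ in $\mathbb{R}^2$, none through the origin, where $L_i=\{x:\langle x,p_i\rangle=1\}$ for a nonzero $p_i\in\mathbb{R}^2$, such that $L_i$ and $L_j$ are not parallel whenever $ij\in E$. For $ij\in E$ put $s_{ij}=1/\det[p_i\ p_j]$; the crossing point of $L_i$ and $L_j$ is $q_{ij}=s_{ij}\rho(p_i-p_j)=q_{ji}$. A lifting of the grillage is a vector $v=(v_1,\dots,v_n)\in(\mathbb{R}^2)^n$ (with $v_i$ the linear height function $x\mapsto\langle x,v_i\rangle$ on $L_i$) such that $\langle q_{ij},v_i-v_j\rangle=0$ for all $ij\in E$. The trivial liftings are those of the form $v_i=w+c\,p_i$ for all $i$, with $w\in\mathbb{R}^2$ and $c\in\mathbb{R}$. The dimension $\ell$ of the space of non-trivial liftings is the dimension of the space of all liftings modulo the subspace of trivial liftings. A Whiteley stress of the grillage is a vector $\omega\in\mathbb{R}^E$ (with no sign restriction) such that $$\sum_{ij\in E,\ i<j}\omega_{ij}\langle q_{ij},v_i-v_j\rangle=0\quad\text{for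 all }v\in(\mathbb{R}^2)^n.$$ *)

(* Defs.v *)
From HB Require Import structures.
From mathcomp Require Import all_boot all_order perm all_algebra.
From mathcomp Require Import boolp classical_sets reals.

Set Implicit Arguments.
Unset Strict Implicit.
Unset Printing Implicit Defensive.

Import Order.TTheory GRing.Theory Num.Theory.
Local Open Scope ring_scope.

Section Plane.
Variable R : realType.
Implicit Types u v x : 'cV[R]_2.

Definition dot u v : R := \sum_k u k 0 * v k 0.

Definition rho x : 'cV[R]_2 :=
  \col_k (if k == 0 then - x 1 0 else x 0 0).

Definition det2 u v : R := \det (row_mx u v : 'M[R]_2).

Definition line u : set 'cV[R]_2 := [set x | dot x u = 1]%classic.

(* L is a translate of M; in particular every line is parallel to itself. *)
Definition parallel (L M : set 'cV[R]_2) : Prop :=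
  exists t : 'cV[R]_2, L = [set x + t | x in M]%classic.

Lemma dotDr u v w : dot u (v + w) = dot u v + dot u w.
Proof.
by rewrite /dot -big_split; apply: eq_bigr => k _; rewrite /= !mxE mulrDr.
Qed.

Lemma dotZr u a v : dot u (a *: v) = a * dot u v.
Proof.
by rewrite /dot mulr_sumr; apply: eq_bigr => k _; rewrite !mxE mulrCA.
Qed.

Lemma dotNr u v : dot u (- v) = - dot u v.
Proof. by rewrite -scaleN1r dotZr mulN1r. Qed.

Lemma dotZl u a v : dot (a *: u) v = a * dot u v.
Proof.
by rewrite /dot mulr_sumr; apply: eq_bigr => k _; rewrite !mxE mulrA.
Qed.

Lemma dot_rho x : dot (rho x) x = 0.
Proof.
rewrite /dot !big_ord_recl big_ord0 !mxE /= addr0.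
have -> : lift ord0 ord0 = 1 :> 'I_2 by apply: val_inj.
have -> : ord0 = 0 :> 'I_2 by [].
by rewrite mulNr mulrC addNr.
Qed.

Lemma rhoN x : rho (- x) = - rho x.
Proof. by apply/matrixP => i j; rewrite !mxE; case: ifP. Qed.

Lemma row_mx_col0 u v i : (row_mx u v : 'M[R]_2) i 0 = u i 0.
Proof.
have -> : 0 = @lshift 1 1 0 :> 'I_2 by apply: val_inj.
by rewrite (@row_mxEl _ 2 1 1).
Qed.

Lemma row_mx_col1 u v i : (row_mx u v : 'M[R]_2) i 1 = v i 0.
Proof.
have -> : 1 = @rshift 1 1 0 :> 'I_2 by apply: val_inj.
by rewrite (@row_mxEr _ 2 1 1).
Qed.

Lemma det2C u v : det2 v u = - det2 u v.
Proof.
rewrite /det2.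
have -> : (row_mx v u : 'M[R]_2) = xcol 0 1 (row_mx u v : 'M[R]_2).
  apply/matrixP => i j; rewrite [RHS]mxE.
  have [->|->] : j = 0 \/ j = 1.
    by case: j => -[|[|//]] hj; [left|right]; apply: val_inj.
  - by rewrite tpermL row_mx_col0 row_mx_col1.
  - by rewrite tpermR row_mx_col0 row_mx_col1.
by rewrite xcolE det_mulmx /tperm_mx det_perm odd_tperm /= expr1 mulrN1.
Qed.

End Plane.

(* A simple graph on 'I_n is a symmetric irreflexive relation e. *)
Section Grillage.
Variables (R : realType) (n : nat) (e : rel 'I_n) (p : 'I_n -> 'cV[R]_2).

Definition grillage : Prop :=
  [/\ forall i, p i != 0,
      forall i j, i <> j -> line (p i) <> line (p j)
    & forall i j, e i j -> ~ parallel (line (p i)) (line (p j))].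

Definition crossing (i j : 'I_n) : 'cV[R]_2 :=
  (det2 (p i) (p j))^-1 *: rho (p i - p j).

(* Each edge is represented once, by its increasing pair of endpoints. *)
Definition edge := {ij : 'I_n * 'I_n | (ij.1 < ij.2)%N && e ij.1 ij.2}.

Definition src (ed : edge) : 'I_n := (val ed).1.
Definition tgt (ed : edge) : 'I_n := (val ed).2.

Definition config := {ffun 'I_n -> 'cV[R]_2}.
Definition edge_weight := {ffun edge -> R^o}.
HB.instance Definition _ := Vector.on config.
HB.instance Definition _ := Vector.on edge_weight.

Definition lifting (v : config) : Prop :=
  forall i j, e i j -> dot (crossing i j) (v i - v j) = 0.

Definition trivial_lifting (v : config) : Prop :=
  exists (w : 'cV[R]_2) (c : R), forall i, v i = w + c *: p i.

Definition gap (v : config) (ed : edge) : R :=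
  dot (crossing (src ed) (tgt ed)) (v (src ed) - v (tgt ed)).

Definition whiteley_stress (omega : edge_weight) : Prop :=
  forall v : config, \sum_(ed : edge) omega ed * gap v ed = 0.

(* The subspaces cut out by the three predicates above: see liftingsP,        *)
(* trivial_liftingsP and whiteley_stressesP.                                  *)

Definition gap_map (v : config) : edge_weight := [ffun ed => gap v ed].

Definition trivial_map (wc : 'cV[R]_2 * R^o) : config :=
  [ffun i => wc.1 + wc.2 *: p i].

Definition stress_form (omega : edge_weight) (v : config) : R^o :=
  \sum_(ed : edge) omega ed * gap v ed.

Lemma gap_is_linear ed a u v : gap (a *: u + v) ed = a * gap u ed + gap v ed.
Proof.
rewrite /gap !ffunE !(dotDr, dotNr, dotZr) mulrDr mulrN opprD.
by rewrite addrACA.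
Qed.

Lemma gap_map_is_linear : linear gap_map.
Proof. by move=> a u v; apply/ffunP => ed; rewrite !ffunE gap_is_linear. Qed.
HB.instance Definition _ :=
  GRing.isLinear.Build R config edge_weight _ gap_map gap_map_is_linear.

Lemma trivial_map_is_linear : linear trivial_map.
Proof.
move=> a u v; apply/ffunP => i; rewrite !ffunE /=.
by rewrite scalerDl scalerDr scalerA addrACA.
Qed.
HB.instance Definition _ :=
  GRing.isLinear.Build R ('cV[R]_2 * R^o)%type config _ trivial_map
    trivial_map_is_linear.

Lemma stress_form_is_linear omega : linear (stress_form omega).
Proof.
move=> a u v; rewrite /stress_form scaler_sumr -big_split /=.
by apply: eq_bigr => ed _; rewrite gap_is_linear mulrDr mulrCA.
Qed.
HB.instance Definition _ omega :=
  GRing.isLinear.Build R config R^o _ (stress_form omega)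
    (stress_form_is_linear omega).

Definition stress_map (omega : edge_weight) : 'Hom(config, R^o) :=
  linfun (stress_form omega).

Lemma stress_map_is_linear : linear stress_map.
Proof.
move=> a s t; apply/lfunP => v; rewrite add_lfunE scale_lfunE !lfunE /=.
rewrite /stress_form scaler_sumr -big_split /=.
by apply: eq_bigr => ed _; rewrite !ffunE mulrDl -mulrA.
Qed.
HB.instance Definition _ :=
  GRing.isLinear.Build R edge_weight 'Hom(config, R^o) _ stress_map
    stress_map_is_linear.

Definition liftings : {vspace config} := lker (linfun gap_map).
Definition trivial_liftings : {vspace config} := limg (linfun trivial_map).
Definition whiteley_stresses : {vspace edge_weight} := lker (linfun stress_map).

(* trivial_liftings is contained in liftings (see trivial_sub_liftings), and  *)
(* a complement of it in liftings is isomorphic to the quotient.              *)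
Definition dim_nontrivial_liftings : nat :=
  \dim (liftings :\: trivial_liftings)%VS.

Lemma crossingC i j : crossing i j = crossing j i.
Proof.
by rewrite /crossing det2C invrN -opprB rhoN scaleNr scalerN opprK.
Qed.

Lemma liftingsP v : symmetric e -> irreflexive e ->
  v \in liftings <-> lifting v.
Proof.
move=> e_sym e_irr; rewrite memv_ker lfunE /=; split.
- move=> /eqP/ffunP gv i j.
  wlog ltij : i j / (i < j)%N => [hw eij|eij].
    have [ltij|ltji|/val_inj eqij] := ltngtP i j; first exact: hw.
      rewrite crossingC -opprB dotNr hw ?oppr0 //.
      by rewrite e_sym.
    by rewrite eqij e_irr in eij.
  have hij : ((i, j).1 < (i, j).2)%N && e (i, j).1 (i, j).2 by rewrite ltij.
  by have := gv (Sub (i, j) hij : edge); rewrite !ffunE /gap /src /tgt SubK.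
- move=> lv; apply/eqP/ffunP => ed; rewrite !ffunE.
  by apply: lv; case/andP: (valP ed).
Qed.

Lemma trivial_liftingsP v : v \in trivial_liftings <-> trivial_lifting v.
Proof.
split=> [/memv_imgP[[w c] _ ->]|[w [c vE]]].
  by exists w, c => i; rewrite lfunE /= ffunE.
apply/memv_imgP; exists (w, c : R^o); first exact: memvf.
by rewrite lfunE; apply/ffunP => i; rewrite ffunE vE.
Qed.

Lemma whiteley_stressesP omega :
  omega \in whiteley_stresses <-> whiteley_stress omega.
Proof.
rewrite memv_ker lfunE /=; split=> [/eqP/lfunP h v|h].
  by have := h v; rewrite zero_lfunE lfunE.
by apply/eqP/lfunP => v; rewrite zero_lfunE lfunE; apply: h.
Qed.

Lemma trivial_sub_liftings : symmetric e -> irreflexive e ->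
  (trivial_liftings <= liftings)%VS.
Proof.
move=> e_sym e_irr; apply/subvP => v /trivial_liftingsP[w [c vE]].
apply/(liftingsP v e_sym e_irr) => i j _; rewrite !vE opprD addrACA subrr add0r.
by rewrite -scalerBr dotZr /crossing dotZl dot_rho !mulr0.
Qed.

End Grillage.

(* Main.v *)
Require Import Defs.
From HB Require Import structures.
From mathcomp Require Import all_boot all_order all_algebra.
From mathcomp Require Import reals.
From mathcomp Require Import zify.

Local Open Scope ring_scope.

Import GRing.Theory Num.Theory.

(** The identity is rank-nullity for the gap map [v |-> (gap v ij)_(ij in E)],
    read once on each side.  Let [r] be its rank.

    The liftings are the kernel of the gap map, which starts from a space of
    dimension [2n], so they have dimension [2n - r] ([dim_liftings]).  The
    stresses are the weights orthogonal to the image of the gap map in [R^E], so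
    they have dimension [m - r] ([dim_whiteley_stresses]): over an ordered field
    the standard pairing is anisotropic, and every subspace is complementary to
    its orthogonal ([dim_orthogonal]).  Subtracting the two dimensions eliminates
    [r] and leaves [2n - m].

    The [3] is the dimension of the trivial liftings: [(w, c)] is determined by
    the lifting [w + c p_i] as soon as two of the [p_i] differ
    ([dim_trivial_liftings]), which holds because the grillage has at least two
    lines and they are distinct.  The trivial liftings lie in the kernel of the
    gap map, so passing to the quotient removes exactly these [3] dimensions. *)

(** * Orthogonality in a space of functions on a finite set *)

Section Orthogonality.
Set Implicit Arguments.
Unset Strict Implicit.
Variables (F : realFieldType) (I : finType).
Implicit Types (x y : {ffun I -> F^o}) (U S : {vspace {ffun I -> F^o}}).

Lemma dim_ffun_regular : \dim {: {ffun I -> F^o}} = #|I|.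
Proof. by rewrite dimvf /dim /= muln1. Qed.

Definition pairing x y : F := \sum_i x i * y i.

Lemma pairing_eq0 x : pairing x x = 0 -> x = 0.
Proof.
move=> /psumr_eq0P x0; apply/ffunP => i; rewrite ffunE.
have /eqP := x0 (fun j _ => sqr_ge0 (x j)) i isT.
by rewrite mulf_eq0 orbb => /eqP.
Qed.

Lemma pairing_sumr x (J : finType) (a : J -> F) (Y : J -> {ffun I -> F^o}) :
  pairing x (\sum_j a j *: Y j) = \sum_j a j * pairing x (Y j).
Proof.
rewrite /pairing; under [RHS]eq_bigr do rewrite mulr_sumr.
rewrite [RHS]exchange_big; apply: eq_bigr => i _.
rewrite sum_ffunE mulr_sumr; apply: eq_bigr => j _.
by rewrite !ffunE mulrCA.
Qed.

(** Its kernel is the orthogonal of [U], so that the orthogonal of [U] is cut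
    out by [\dim U] linear equations. *)
Definition pairing_vbasis U x : {ffun 'I_(\dim U) -> F^o} :=
  [ffun k : 'I_(\dim U) => pairing x (vbasis U)`_k].

Lemma pairing_vbasis_is_linear U : linear (pairing_vbasis U).
Proof.
move=> a x y; apply/ffunP => k; rewrite !ffunE /pairing scaler_sumr -big_split.
by apply: eq_bigr => i _; rewrite !ffunE mulrDl -mulrA.
Qed.
HB.instance Definition _ U :=
  GRing.isLinear.Build F {ffun I -> F^o} {ffun 'I_(\dim U) -> F^o} _
    (pairing_vbasis U) (pairing_vbasis_is_linear U).

(** A vector both in [U] and orthogonal to [U] is orthogonal to itself, hence
    zero because a sum of squares vanishes only trivially; this gives [<=].
    For [>=], the orthogonal is the solution space of [\dim U] equations. *)
Lemma dim_orthogonal U S :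
    (forall x, x \in S <-> {in U, forall y, pairing x y = 0}) ->
  (\dim U + \dim S = #|I|)%N.
Proof.
move=> SP; apply/eqP; rewrite eqn_leq; apply/andP; split.
  rewrite -dimv_disjoint_sum; first by rewrite -dim_ffun_regular dimvS ?subvf.
  apply/eqP; rewrite -subv0; apply/subvP => x.
  rewrite memv_cap memv0 => /andP[xU /SP xS].
  by apply/eqP/pairing_eq0/xS.
pose g := linfun (pairing_vbasis U).
have kerg : (lker g <= S)%VS.
  apply/subvP => x; rewrite memv_ker lfunE => /eqP gx0; apply/SP => y yU.
  rewrite (coord_vbasis yU) pairing_sumr big1 // => k _.
  by have /ffunP/(_ k) := gx0; rewrite !ffunE => ->; rewrite mulr0.
rewrite -dim_ffun_regular -(limg_ker_dim g fullv) capfv addnC.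
rewrite leq_add ?dimvS //.
by rewrite (leq_trans (dimvS (subvf _))) // dimvf /dim /= card_ord muln1.
Qed.

End Orthogonality.

(** * Dimensions of the spaces attached to a grillage *)

Section Dimensions.
Set Implicit Arguments.
Unset Strict Implicit.
Variables (R : realType) (n : nat) (e : rel 'I_n) (p : 'I_n -> 'cV[R]_2).

Lemma dim_liftings :
  (\dim (liftings e p) + \dim (limg (linfun (gap_map e p))) = 2 * n)%N.
Proof.
by rewrite -[liftings e p]capfv limg_ker_dim dimvf /dim /= card_ord mulnC
  dim_matrix.
Qed.

Lemma dim_whiteley_stresses :
  (\dim (limg (linfun (gap_map e p))) + \dim (whiteley_stresses e p)
    = #|{: edge e}|)%N.
Proof.
apply: dim_orthogonal => omega; have stressP := whiteley_stressesP p omega.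
split=> [/stressP h _ /memv_imgP[v _ ->]|h].
  by rewrite lfunE -[RHS](h v); apply: eq_bigr => ed _; rewrite ffunE.
apply/stressP => v.
rewrite -[RHS](h _ (memv_img (linfun (gap_map e p)) (memvf v))).
by rewrite lfunE; apply: eq_bigr => ed _; rewrite ffunE.
Qed.

(** If [w + c p_k = 0] for all [k], then [c (p_i - p_j) = 0], so [c = 0] and
    then [w = 0]: the parametrization by [(w, c)] is injective. *)
Lemma dim_trivial_liftings i j :
  p i != p j -> \dim (trivial_liftings p) = 3.
Proof.
move=> neq_p; rewrite /trivial_liftings limg_dim_eq; first by rewrite dimvf /dim.
apply/eqP; rewrite capfv -subv0; apply/subvP => -[w c].
rewrite memv_ker lfunE memv0 => /eqP/ffunP triv0.
have triv_k k : w + c *: p k = 0 by have := triv0 k; rewrite !ffunE.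
have c0 : c = 0.
  have /eqP : c *: (p i - p j) = 0.
    by rewrite scalerBr; apply/eqP; rewrite subr_eq0 -(inj_eq (addrI w)) !triv_k.
  by rewrite scaler_eq0 subr_eq0 (negPf neq_p) orbF => /eqP.
by have := triv_k i; rewrite c0 scale0r addr0 => ->.
Qed.

End Dimensions.

Theorem theorem4p11 (R : realType) (n : nat) (e : rel 'I_n)
    (p : 'I_n -> 'cV[R]_2) :
  (2 <= n)%N ->
  symmetric e -> irreflexive e ->
  grillage e p ->
  (dim_nontrivial_liftings e p)%:Z - (\dim (whiteley_stresses e p))%:Z + 3
    = 2 * n%:Z - (#|{: edge e}|)%:Z.
Proof.
move=> n2 e_sym e_irr [_ distinct _].
have neq_p : p (Ordinal (ltnW n2)) != p (Ordinal n2).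
  by apply/eqP => eq_p; apply: (distinct _ _ _ (congr1 _ eq_p)).
have := dimv_cap_compl (liftings e p) (trivial_liftings p).
rewrite (capv_idPr (trivial_sub_liftings _ e_sym e_irr)).
rewrite (dim_trivial_liftings neq_p).
have := dim_liftings e p; have := dim_whiteley_stresses e p.
rewrite /dim_nontrivial_liftings; lia.
Qed.
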